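(* Let $A = (2\cdot 3\cdot 5\cdot 7\cdot 11)^{9}$. For almost all primes $p$, there are positive integers $m,n$ such that $p$ divides $$\prod_{a \mid A,\ a>1} (a^m + a^n + 1),$$ where the product is over the positive divisors $a>1$ of $A$.
   Context: A statement holds for almost all primes $p$ if, as $x\to\infty$, the number of primes $p\le x$ for which it fails is $o(x/\log x)$. *)

(* Defs.v *)
From mathcomp Require Export all_boot all_order all_algebra.
From mathcomp Require Export all_classical all_reals all_analysis.
Export Order.TTheory GRing.Theory Num.Theory.
Export numFieldNormedType.Exports.

Set Implicit Arguments.
Unset Strict Implicit.
Unset Printing Implicit Defensive.

Local Open Scope ring_scope.

(* The Landau notations need a canonical [filter_on] structure, which the
   library does not declare for +oo. *)
Canonical pinfty_filter_on (R : realType) : filter_on R :=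
  FilterType (pinfty_nbhs R) _.

(* The number of primes p <= x for which P p fails; for x >= 0, the condition
   p%:R <= x amounts to p <= Num.truncn x. *)
Definition prime_exceptions (R : realType) (P : nat -> Prop) (x : R) : nat :=
  #|[set p : 'I_(Num.truncn x).+1 | prime p && `[< ~ P p >]]%SET|.

Definition almost_all_primes (R : realType) (P : nat -> Prop) : Prop :=
  (fun x : R => (prime_exceptions P x)%:R : R) =o_ (pinfty_nbhs R)
  (fun x : R => x / ln x).

(* Main.v *)
Require Import Defs.
From mathcomp Require Import fingroup cyclic finalg zify ring.

Set Implicit Arguments.
Unset Strict Implicit.
Unset Printing Implicit Defensive.

(** Why the theorem holds.

    Let [a] have order [h] modulo [p]. If [h ^ 4 > p ^ 3], the equation
    [x + y + 1 = 0] has a solution with [x] and [y] powers of [a]: the order is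
    large enough for a second-moment count of incidences between points and
    lines over the field with [p] elements
    ([solution_of_large_subgroup]). So it is enough to find, for almost all [p],
    a divisor [a] of [A] of order larger than [p ^ (3 / 4)].

    No fixed [a] is known to have this property, but the subgroup generated by
    the [r = 5] primes 2, 3, 5, 7, 11 has order at least [p ^ (5 / 6 - eps)] for
    almost all [p]. Indeed, if its order is below [K ^ r], two monomials in the
    primes with exponents below [K] agree modulo [p], hence [p] divides one of
    about [(2 K) ^ r] nonzero integers with [O(K)] digits; this leaves
    [O(K ^ r.+1)] primes ([count_collisions]), and [K] can be taken slightly
    smaller than [x ^ (1 / r.+1)].

    It remains to pass from the subgroup to one of its elements. Consider all
    [B ^ r] monomials in the generators with exponents below [B = 10]; they are
    the divisors of [A]. For each prime [q], all but [B ^ r.-1] of them have an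
    order divisible, up to a bounded factor, by the full power of [q] in the
    order of the subgroup ([few_small_valuations]). Multiplying the orders, and
    discarding the trivial monomial 1, some [a > 1] has an order of at least a
    constant times the power of exponent
    [(B ^ r - B ^ r.-1) / (B ^ r - 1) = 90000 / 99999] of the order of the
    subgroup ([exists_large_order]). As [5 / 6 * 90000 / 99999] exceeds [3 / 4],
    by very little, the order of [a] is large enough. *)

(** * Valuations, powers and prime divisors *)

Lemma leq_expn (m n e : nat) : m <= n -> m ^ e <= n ^ e.
Proof. by move=> mn; have [->|e_gt0] := posnP e; rewrite ?expn0 // leq_exp2r. Qed.

Lemma biglcmn_gt0 (I : finType) (n : I -> nat) :
  (forall i, 0 < n i) -> 0 < \big[lcmn/1]_i n i.
Proof.
move=> n_gt0; apply: (big_ind (fun m => 0 < m)) => // a b a_gt0 b_gt0.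
by rewrite lcmn_gt0 a_gt0.
Qed.

Lemma logn_prod_pos (I : finType) (n : I -> nat) (q : nat) :
  (forall i, 0 < n i) -> logn q (\prod_i n i) = \sum_i logn q (n i).
Proof.
move=> n_gt0; suff /andP[_ /eqP] : (0 < \prod_i n i) &&
    (logn q (\prod_i n i) == \sum_i logn q (n i)) by [].
elim/big_rec2: _ => [|i m M _ /andP[M_gt0 /eqP<-]]; first by rewrite logn1.
by rewrite muln_gt0 n_gt0 M_gt0 lognM ?eqxx.
Qed.

Lemma exists_logn_biglcmn (I : finType) (n : I -> nat) (q : nat) :
  (forall i, 0 < n i) -> 0 < logn q (\big[lcmn/1]_i n i) ->
  exists i, logn q (\big[lcmn/1]_i n i) = logn q (n i).
Proof.
move=> n_gt0 v_gt0.
have /andP[_ /eqP vE] : (0 < \big[lcmn/1]_i n i) &&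
    (logn q (\big[lcmn/1]_i n i) == \max_i logn q (n i)).
  elim/big_rec2: _ => [|i m M _ /andP[M_gt0 /eqP<-]]; first by rewrite logn1.
  by rewrite lcmn_gt0 n_gt0 M_gt0 logn_lcm ?eqxx.
have I_gt0 : 0 < #|I|.
  rewrite lt0n; apply: contraTneq v_gt0 => /card0_eq I0.
  by rewrite vE big_pred0 // => i; have := I0 i; rewrite inE.
by rewrite vE; have [i ->] := bigop.eq_bigmax (fun i => logn q (n i)) I_gt0; exists i.
Qed.

Lemma logn_quotient_gcd (q m n : nat) : 0 < m -> 0 < n ->
  0 < logn q (m %/ gcdn m n) ->
  logn q m = logn q (m %/ gcdn m n) + logn q n.
Proof.
move=> m_gt0 n_gt0; rewrite logn_div ?dvdn_gcdl // logn_gcd //; lia.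
Qed.

Lemma dvdn_of_logn (m n : nat) : 0 < m -> 0 < n ->
  (forall q, logn q m <= logn q n) -> m %| n.
Proof.
move=> m_gt0 n_gt0 le_mn; apply/(dvdn_partP n m_gt0) => q.
by rewrite mem_primes => /and3P[q_pr _ _]; rewrite p_part pfactor_dvdn.
Qed.

(** The distinct primes dividing [M], each at least 2, have a product at most [M]. *)
Lemma card_prime_divisors (n M : nat) (S : {set 'I_n}) : 0 < M ->
  (forall p : 'I_n, p \in S -> prime p && (p %| M)) -> 2 ^ #|S| <= M.
Proof.
move=> M_gt0 S_dvd.
have size_S : #|S| <= size (primes M).
  rewrite cardE -(size_map val); apply: uniq_leq_size.
    by rewrite (map_inj_uniq val_inj) enum_uniq.
  move=> _ /mapP[p pS ->]; rewrite mem_enum in pS.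
  by have /andP[p_pr p_dvd] := S_dvd p pS; rewrite mem_primes p_pr M_gt0.
apply: leq_trans (_ : 2 ^ size (primes M) <= M); first by rewrite leq_exp2l.
rewrite [leqRHS]prod_prime_decomp // /primes size_map.
have : forall f, f \in prime_decomp M -> 2 <= f.1 ^ f.2.
  case=> p e /= pe; have [p_pr e_gt0 _] := mem_prime_decomp pe.
  apply: leq_trans (prime_gt1 p_pr) _.
  by rewrite -[leqLHS]expn1 leq_pexp2l // prime_gt0.
elim: (prime_decomp M) => [|f s IHs] ge2; first by rewrite big_nil.
rewrite big_cons expnS leq_mul ?ge2 ?mem_head // IHs // => f' f's.
by rewrite ge2 // inE f's orbT.
Qed.

(** * An element of large order in a group with given generators *)

Lemma card_ffun_determined_off (r B : nat) (i : 'I_r) (S : {set {ffun 'I_r -> 'I_B}}) :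
  (forall e f, e \in S -> f \in S -> (forall j, j != i -> e j = f j) -> e i = f i) ->
  #|S| <= B ^ r.-1.
Proof.
move=> detS.
pose off (e : {ffun 'I_r -> 'I_B}) := [ffun j : {j | j != i} => e (val j)].
have off_inj : {in S &, injective off}.
  move=> e f eS fS eq_off.
  have eq_ef j : j != i -> e j = f j.
    by move=> ji; have /ffunP/(_ (Sub j ji)) := eq_off; rewrite !ffunE.
  apply/ffunP => j; have [->|/eq_ef //] := eqVneq j i; exact: detS.
rewrite -(card_in_imset off_inj) (leq_trans (max_card _)) // card_ffun card_sig.
by rewrite !card_ord cardC1 card_ord.
Qed.

Lemma val_unit_prod (R : finComUnitRingType) (I : finType) (u : I -> {unit R}) :
  val (\prod_i u i)%g = (\prod_i val (u i))%R.
Proof. exact: (big_morph _ (@FinRing.val_unitM R) (FinRing.val_unit1 R)). Qed.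

Lemma monomial_split (R : finComUnitRingType) (r : nat) (g : 'I_r -> {unit R})
    (e f : 'I_r -> nat) (i : 'I_r) :
  (forall j, j != i -> e j = f j) -> f i <= e i ->
  (\prod_j g j ^+ e j = (\prod_j g j ^+ f j) * g i ^+ (e i - f i))%g.
Proof.
move=> eq_ef le_fe; apply: val_inj.
rewrite FinRing.val_unitM !val_unit_prod (bigD1 i) //= [X in (_ = X * _)%R](bigD1 i) //=.
rewrite -[LHS]mulrC -mulrA [RHS]mulrC -mulrA -!FinRing.val_unitM -expgD subnK //.
by congr (_ * _)%R; apply: eq_bigr => j /eq_ef ->.
Qed.

(** The set in question is determined off one coordinate. Let [i] be an index
    at which [g i] carries the full power of [q] in the lcm [E] of the orders.
    If [e] and [f] lie in the set and differ only at [i], the quotient of their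
    monomials is [g i ^+ d] with [0 < d < B], and its order has [q]-valuation
    below that of [L]. Then [q] would have to divide [d] more often than it
    divides [(B.-1)`!], a multiple of [d]; this is the reason for dividing [E]
    by its gcd with this factorial. *)
Lemma few_small_valuations (R : finComUnitRingType) (r B q : nat)
    (g : 'I_r -> {unit R}) (E := \big[lcmn/1]_i #[g i]%g)
    (L := E %/ gcdn E (B.-1)`!) :
  #|[set e : {ffun 'I_r -> 'I_B} |
      logn q #[(\prod_i g i ^+ e i)%g]%g < logn q L]%SET| <= B ^ r.-1.
Proof.
have E_gt0 : 0 < E by apply: biglcmn_gt0 => i; apply: order_gt0.
have [L0|L_gt0] := posnP (logn q L).
  by rewrite L0 (eq_card0 _) // => e; rewrite inE ltn0.
have vE := logn_quotient_gcd (q := q) E_gt0 (fact_gt0 _) L_gt0; rewrite -/L in vE.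
have [|i Ei] := exists_logn_biglcmn (q := q) (fun i => order_gt0 (g i)).
  by rewrite -/E vE addn_gt0 L_gt0.
apply: (card_ffun_determined_off (i := i)) => e f; rewrite !inE.
wlog le_fe : e f / f i <= e i => [th|small_e small_f eq_ef].
  case: (leqP (f i) (e i)) => [|/ltnW] le small_e small_f eq_ef; first exact: th.
  by symmetry; apply: th => // j /eq_ef.
apply/eqP; rewrite -val_eqE eqn_leq le_fe andbT leqNgt; apply/negP => lt_fe.
pose x (u : {ffun 'I_r -> 'I_B}) := (\prod_i g i ^+ u i)%g.
rewrite -/(x e) in small_e; rewrite -/(x f) in small_f.
have xE : x e = (x f * g i ^+ (e i - f i))%g.
  by apply: monomial_split => // j /eq_ef ->.
pose d := e i - f i; pose m := lcmn #[x e]%g #[x f]%g.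
have m_gt0 : 0 < m by rewrite lcmn_gt0 !order_gt0.
have d_gt0 : 0 < d by rewrite subn_gt0.
have dm : #[g i]%g %| d * m.
  rewrite order_dvdn expgM.
  have -> : (g i ^+ d = (x f)^-1 * x e)%g by rewrite xE mulKg.
  have cU (u v : {unit R}) : commute u v.
    by apply: val_inj; rewrite !FinRing.val_unitM mulrC.
  rewrite expgMn // expgVn.
  have /eqP-> : (x f ^+ m == 1)%g by rewrite -order_dvdn dvdn_lcmr.
  have /eqP-> : (x e ^+ m == 1)%g by rewrite -order_dvdn dvdn_lcml.
  by rewrite invg1 mulg1.
have dF : d %| (B.-1)`!.
  by rewrite dvdn_fact // d_gt0 /=; have := ltn_ord (e i); rewrite /d; lia.
have [le1 le2] : logn q (#[g i]%g) <= logn q (d * m) /\ logn q d <= logn q (B.-1)`!.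
  by split; apply: dvdn_leq_log; rewrite ?fact_gt0 ?muln_gt0 ?d_gt0.
move: le1; rewrite lognM // logn_lcm ?order_gt0 // -Ei -/E vE; lia.
Qed.

(** The product of the orders of all [B ^ r] monomials is divisible by
    [L ^ (B ^ r - B ^ r.-1)]: for each prime, all but [B ^ r.-1] of them carry at
    least the valuation of [L]. The monomial with zero exponents has order 1, so
    the product has only [(B ^ r).-1] nontrivial factors, and one of them is
    large. Leaving out that factor is what makes the exponent of [L] strictly
    better than [1 - 1 / B]. *)
Lemma exists_large_order (R : finComUnitRingType) (r B : nat)
    (g : 'I_r -> {unit R}) (E := \big[lcmn/1]_i #[g i]%g)
    (L := E %/ gcdn E (B.-1)`!) : 0 < B ->
  exists e : {ffun 'I_r -> 'I_B},
    L ^ (B ^ r - B ^ r.-1) <= #[(\prod_i g i ^+ e i)%g]%g ^ (B ^ r).-1.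
Proof.
move=> B_gt0.
pose h (e : {ffun 'I_r -> 'I_B}) := #[(\prod_i g i ^+ e i)%g]%g.
have E_gt0 : 0 < E by apply: biglcmn_gt0 => i; apply: order_gt0.
have L_gt0 : 0 < L by rewrite divn_gt0 ?gcdn_gt0 ?E_gt0 // dvdn_leq ?dvdn_gcdl.
have card_box : #|{ffun 'I_r -> 'I_B}| = B ^ r by rewrite card_ffun !card_ord.
have L_dvd : L ^ (B ^ r - B ^ r.-1) %| \prod_e h e.
  apply: dvdn_of_logn => [||q]; rewrite ?expn_gt0 ?L_gt0 //.
    by rewrite prodn_gt0 // => e; apply: order_gt0.
  rewrite lognX logn_prod_pos => [|e]; last exact: order_gt0.
  pose S := [set e | logn q (h e) < logn q L]%SET.
  have S_le : #|S| <= B ^ r.-1 := few_small_valuations B q g.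
  rewrite (bigID (mem (~: S)%SET)) /=; apply: leq_trans (leq_addr _ _).
  apply: (@leq_trans (\sum_(e in (~: S)%SET) logn q L)).
    by rewrite sum_nat_const leq_mul2r cardsCs finset.setCK card_box leq_sub2l ?orbT.
  by apply: leq_sum => e; rewrite !inE -leqNgt.
pose e0 : {ffun 'I_r -> 'I_B} := [ffun => Ordinal B_gt0].
have h0 : h e0 = 1.
  rewrite /h big1 ?order1 // => i _; rewrite ffunE; exact: expg0.
pose e1 := [arg max_(e > e0) h e].
exists e1; rewrite -/(h e1).
have max_h e : h e <= h e1 by rewrite /e1; case: arg_maxnP => // e' _; apply.
apply: leq_trans (dvdn_leq _ L_dvd) _.
  by rewrite prodn_gt0 // => e; apply: order_gt0.
rewrite (bigD1 e0) //= h0 mul1n -card_box -(cardC1 e0) -prod_nat_const.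
exact: leq_prod.
Qed.

(** * The equation [x + y + 1 = 0] in a large subgroup *)

(** For [x != y] the map [(s, t) |-> (x s + t, y s + t)] is a bijection of the
    plane: two nonparallel lines meet in exactly one point. *)
Lemma sum_affine_pair (F : finFieldType) (V : nmodType) (x y : F) (f : F -> F -> V) :
  x != y ->
  (\sum_s \sum_t f (x * s + t) (y * s + t) = \sum_u \sum_v f u v)%R.
Proof.
move=> xy; have xy0 : (x - y != 0)%R by rewrite subr_eq0.
rewrite !pair_big /=.
pose phi (z : F * F) := (x * z.1 + z.2, y * z.1 + z.2)%R.
symmetry; rewrite (reindex phi) //=.
pose slope (w : F * F) := ((w.1 - w.2) / (x - y))%R.
exists (fun w : F * F => (slope w, w.1 - x * slope w)%R) => [[s t]|[u v]] _ /=.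
  by rewrite /slope /=; congr pair; field.
by rewrite /phi /slope /=; congr pair; field.
Qed.

(** The number of lines [{(s, t) | x s + t = c}], with slope [x] in [H] and
    [c] in [K], through the point [(s, t)]. *)
Definition incidences (F : finFieldType) (H K : {set F}) (s t : F) : nat :=
  \sum_(x in H) ((x * s + t)%R \in K).

Lemma sum_mem_card (F : finType) (K : {set F}) : \sum_t (t \in K : nat) = #|K|.
Proof. by rewrite -sum1_card [RHS]big_mkcond /=; apply: eq_bigr => t _; case: ifP. Qed.

Lemma sum_incidences (F : finFieldType) (H K : {set F}) :
  \sum_s \sum_t incidences H K s t = #|F| * (#|H| * #|K|).
Proof.
have row s : \sum_t incidences H K s t = #|H| * #|K|.
  rewrite exchange_big /= -sum_nat_const; apply: eq_bigr => x _.
  rewrite (reindex_inj (addrI (- (x * s))%R)) /= -sum_mem_card.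
  by apply: eq_bigr => t _; rewrite addrA subrr add0r.
by under eq_bigr do rewrite row; rewrite sum_nat_const.
Qed.

Lemma sum_incidences_sq (F : finFieldType) (H K : {set F}) :
  \sum_s \sum_t incidences H K s t ^ 2 =
  #|H| * (#|F| * #|K| + #|H|.-1 * #|K| ^ 2).
Proof.
pose k (z : F) := (z \in K : nat).
have -> : \sum_s \sum_t incidences H K s t ^ 2 =
    \sum_(x in H) \sum_(y in H) \sum_s \sum_t k (x * s + t)%R * k (y * s + t)%R.
  under eq_bigr => s _.
    under eq_bigr => t _.
      rewrite -mulnn big_distrl /=; under eq_bigr do rewrite big_distrr /=; over.
    rewrite exchange_big /=; under eq_bigr => x _ do rewrite exchange_big /=; over.
  rewrite exchange_big /=; apply: eq_bigr => x _; rewrite exchange_big /=.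
  by apply: eq_bigr.
rewrite -sum_nat_const; apply: eq_bigr => x xH.
rewrite (bigD1 x) //=; congr (_ + _).
  rewrite -sum_nat_const; apply: eq_bigr => s _.
  rewrite (reindex_inj (addrI (- (x * s))%R)) /= -sum_mem_card.
  by apply: eq_bigr => t _; rewrite addrA subrr add0r /k mulnb andbb.
have -> : #|H|.-1 = #|[pred y | (y \in H) && (y != x)]|.
  by rewrite (cardsD1 x H) xH /=; apply: eq_card => y; rewrite !inE andbC.
rewrite -sum_nat_const; apply: eq_bigr => y /andP[_ yx].
rewrite (sum_affine_pair (fun u v => k u * k v)) 1?eq_sym //.
have sum_k : \sum_u k u = #|K| := sum_mem_card K.
under eq_bigr do rewrite -big_distrr /= sum_k; rewrite -big_distrl /= sum_k.
exact: mulnn.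
Qed.

Lemma sum_const_natr (V : pzRingType) (I : finType) (A : {pred I}) (c : V) :
  (\sum_(i in A) c = c * #|A|%:R)%R.
Proof. by rewrite sumr_const mulr_natr. Qed.

(** The second moment of the incidence function around its mean
    [#|H| * #|K| / #|F|], scaled by [#|F|] to remain in the integers. It is an
    elementary substitute for the square-root bound on character sums over a
    subgroup. *)
Lemma incidence_variance (F : finFieldType) (H K : {set F}) :
  (\sum_s \sum_t (#|F|%:R * (incidences H K s t)%:R - #|H|%:R * #|K|%:R) ^+ 2
   = #|F|%:R ^+ 2 * #|H|%:R * #|K|%:R * (#|F|%:R - #|K|%:R) :> int)%R.
Proof.
have expand (q h k a : int) :
    ((q * a - h * k) ^+ 2 = q ^+ 2 * a ^+ 2 - 2 * (q * h * k) * a + (h * k) ^+ 2)%R.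
  by ring.
have -> : (\sum_s \sum_t (#|F|%:R * (incidences H K s t)%:R - #|H|%:R * #|K|%:R) ^+ 2 =
  #|F|%:R ^+ 2 * (\sum_s \sum_t incidences H K s t ^ 2)%:R
  - 2 * (#|F|%:R * #|H|%:R * #|K|%:R) * (\sum_s \sum_t incidences H K s t)%:R
  + (#|H|%:R * #|K|%:R) ^+ 2 * #|F|%:R * #|F|%:R :> int)%R.
  rewrite !natr_sum !mulr_sumr -sumrB.
  have -> : ((#|H|%:R * #|K|%:R) ^+ 2 * #|F|%:R * #|F|%:R =
      \sum_(s : F) \sum_(t : F) (#|H|%:R * #|K|%:R) ^+ 2 :> int)%R.
    by rewrite !sum_const_natr.
  rewrite -big_split /=; apply: eq_bigr => s _.
  rewrite !natr_sum !mulr_sumr -sumrB -big_split /=; apply: eq_bigr => t _.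
  by rewrite natrX expand.
rewrite sum_incidences sum_incidences_sq !(natrM, natrD, natrX).
have [->|H0] := eqVneq H finset.set0.
  by rewrite cards0 !(mul0r, mulr0, expr0n, subr0, addr0).
have -> : (#|H|.-1%:R = #|H|%:R - 1 :> int)%R.
  by rewrite -[in RHS](@prednK #|H|) ?card_gt0 // -natr1 addrK.
move: (#|F|%:R : int)%R (#|H|%:R : int)%R (#|K|%:R : int)%R => q h k.
by ring.
Qed.

(** Let [q] and [h] be the orders of [F] and [G]. A relation
    [x s + t + z = 0] with all four elements in [G] gives a solution after
    division by [z]. Without such relations, the [h ^ 2] points of [G * G] lie on
    none of the lines with slope in [G] and constant in [- G], so each
    contributes [h ^ 4] to the scaled variance, whose value
    [q ^ 2 h ^ 2 (q - h)] then is at least [h ^ 6]; hence [h ^ 4 <= q ^ 3]. *)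
Lemma solution_of_large_subgroup (F : finFieldType) (G : {group {unit F}}) :
  #|F| ^ 3 < #|G| ^ 4 ->
  exists x y : {unit F}, [/\ x \in G, y \in G & (val x + val y + 1 = 0 :> F)%R].
Proof.
move=> large; apply: contrapT => no_sol; move: large; apply/negP; rewrite -leqNgt.
pose H := (val @: G)%SET : {set F}; pose K := ((@GRing.opp F) @^-1: H)%SET.
have cardH : #|H| = #|G| by rewrite card_imset //; apply: val_inj.
have cardK : #|K| = #|G| by rewrite card_preimset //; apply: oppr_inj.
have no_inc s t : s \in H -> t \in H -> incidences H K s t = 0.
  move=> /imsetP[u uG ->] /imsetP[v vG ->]; apply: big1 => _ /imsetP[w wG ->].
  apply/eqP; rewrite eqb0 inE; apply/negP => /imsetP[z zG zE].
  case: no_sol; exists (w * u * z^-1)%g, (v * z^-1)%g.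
  split; rewrite ?groupM ?groupV // !FinRing.val_unitM FinRing.val_unitV.
  have zU := valP z; rewrite -[1%R](mulrV zU) -!mulrDl -zE.
  by rewrite subrr mul0r.
have var := incidence_variance H K; rewrite cardH cardK in var.
have low : (#|G|%:R ^+ 6 <= #|F|%:R ^+ 2 * #|G|%:R * #|G|%:R * (#|F|%:R - #|G|%:R) :> int)%R.
  rewrite -var.
  have -> : (#|G|%:R ^+ 6 = \sum_(s in H) \sum_(t in H)
      (#|F|%:R * (incidences H K s t)%:R - #|G|%:R * #|G|%:R) ^+ 2 :> int)%R.
    under eq_bigr => s sH do under eq_bigr => t tH do rewrite no_inc // mulr0 sub0r sqrrN.
    by rewrite !sum_const_natr cardH -expr2 -exprM -!exprSr.
  rewrite big_mkcond ler_sum // => s _; case: ifP => _; last first.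
    by rewrite sumr_ge0 // => t _; apply: sqr_ge0.
  by rewrite big_mkcond ler_sum // => t _; case: ifP => _ //; apply: sqr_ge0.
have h_gt0 : (0 < #|G|%:R :> int)%R by rewrite ltr0n cardG_gt0.
have q_ge0 : (0 <= #|F|%:R :> int)%R by [].
rewrite -(ler_nat int) !natrX.
move: (#|F|%:R : int)%R (#|G|%:R : int)%R h_gt0 q_ge0 low => q h h_gt0 q_ge0 low.
rewrite -(ler_pM2l (exprn_gt0 2 h_gt0)) -exprD (le_trans low) // -subr_ge0.
have -> : (h ^+ 2 * q ^+ 3 - q ^+ 2 * h * h * (q - h) = h ^+ 3 * q ^+ 2)%R by ring.
by rewrite mulr_ge0 ?exprn_ge0 // ltW.
Qed.

(** * Primes modulo which two small monomials coincide *)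

Definition monomial (r : nat) (ps : 'I_r -> nat) (u : 'I_r -> nat) : nat :=
  \prod_i ps i ^ u i.

Definition collision (r : nat) (ps : 'I_r -> nat) (K p : nat) : Prop :=
  exists u v : {ffun 'I_r -> 'I_K},
    u != v /\ (monomial ps (fun i => u i) = monomial ps (fun i => v i) %[mod p])%N.

Lemma monomial_gt0 (r : nat) (ps : 'I_r -> nat) (u : 'I_r -> nat) :
  (forall i, prime (ps i)) -> 0 < monomial ps u.
Proof. by move=> ps_prime; rewrite prodn_gt0 // => i; rewrite expn_gt0 prime_gt0. Qed.

Lemma logn_monomial (r : nat) (ps : 'I_r -> nat) (u : 'I_r -> nat) (i : 'I_r) :
  (forall i, prime (ps i)) -> injective ps -> logn (ps i) (monomial ps u) = u i.
Proof.
move=> ps_prime ps_inj.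
rewrite logn_prod_pos => [|j]; last by rewrite expn_gt0 prime_gt0.
rewrite (bigD1 i) //= pfactorK // big1 ?addn0 // => j ji.
by rewrite lognX logn_prime // (inj_eq ps_inj) eq_sym (negPf ji) muln0.
Qed.

Lemma monomial_le (r : nat) (ps : 'I_r -> nat) (b K : nat) (u : 'I_r -> nat) :
  (forall i, prime (ps i)) -> \prod_i ps i <= 2 ^ b -> (forall i, u i <= K) ->
  monomial ps u <= 2 ^ (b * K).
Proof.
move=> ps_prime le_b uK; apply: leq_trans (_ : \prod_i ps i ^ K <= _).
  by rewrite leq_prod // => i _; rewrite leq_pexp2l ?prime_gt0.
rewrite expnM -(big_morph (fun x => x ^ K) (fun x y => expnMn x y K) (exp1n K)).
by have [->|K_gt0] := posnP K; rewrite ?expn0 // leq_exp2r.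
Qed.

Definition distance (x y : nat) : nat := (x - y) + (y - x).

Lemma distance_le (x y z : nat) : x <= z -> y <= z -> distance x y <= z.
Proof. by rewrite /distance; lia. Qed.

Lemma distance_gt0 (x y : nat) : (0 < distance x y) = (x != y).
Proof. by rewrite lt0n addn_eq0 !subn_eq0 -eqn_leq. Qed.

Lemma dvdn_distance (p x y : nat) : x = y %[mod p] -> p %| distance x y.
Proof.
move=> /eqP eq_xy; rewrite /distance dvdn_add //.
  have [le|/ltnW le] := leqP y x; first by rewrite -eqn_mod_dvd.
  by move: le; rewrite -subn_eq0 => /eqP->.
have [le|/ltnW le] := leqP x y; first by rewrite -eqn_mod_dvd // eq_sym.
by move: le; rewrite -subn_eq0 => /eqP->.
Qed.

(** With [w = u + K - v], the two monomials are those of [u] and [v] freed of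
    their common part. Only the [(2 * K) ^ r] differences of exponents matter,
    not the [K ^ (2 * r)] pairs: the count of collisions needs this saving. *)
Definition monomial_gap (r : nat) (ps : 'I_r -> nat) (K : nat) (w : 'I_r -> nat) : nat :=
  distance (monomial ps (fun i => w i - K)) (monomial ps (fun i => K - w i)).

Lemma monomial_gap_gt0 (r : nat) (ps : 'I_r -> nat) (K : nat) (w : 'I_r -> nat) (i : 'I_r) :
  (forall i, prime (ps i)) -> injective ps -> w i != K -> 0 < monomial_gap ps K w.
Proof.
move=> ps_prime ps_inj wK; rewrite distance_gt0; apply: contra wK => /eqP eq_mon.
have := congr1 (logn (ps i)) eq_mon; rewrite !logn_monomial //; lia.
Qed.

Lemma dvdn_monomial_gap (r : nat) (ps : 'I_r -> nat) (K p : nat) (u v : 'I_r -> nat) :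
  prime p -> ~~ (p %| \prod_i ps i) -> (forall i, v i <= K) ->
  monomial ps u = monomial ps v %[mod p] ->
  p %| monomial_gap ps K (fun i => u i + K - v i).
Proof.
have left_part x y : y <= K -> x = x + K - y - K + minn x y by lia.
have right_part x y : y <= K -> y = K - (x + K - y) + minn x y by lia.
move=> p_pr p_ps vK eq_uv; set w := fun i => _.
pose m := monomial ps (fun i => minn (u i) (v i)).
have uE : monomial ps u = monomial ps (fun i => w i - K) * m.
  rewrite /m /w /monomial -big_split /=; apply: eq_bigr => i _; rewrite -expnD.
  by congr (_ ^ _); apply: left_part.
have vE : monomial ps v = monomial ps (fun i => K - w i) * m.
  rewrite /m /w /monomial -big_split /=; apply: eq_bigr => i _; rewrite -expnD.
  by congr (_ ^ _); apply: right_part.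
have p_m : coprime p m.
  rewrite coprime_sym; apply: (big_ind (fun x => coprime x p)) => [|x y xp yp|i _].
  - exact: coprime1n.
  - by rewrite coprimeMl xp.
  rewrite coprimeXl // coprime_sym prime_coprime //.
  by apply: contra p_ps => p_i; rewrite (bigD1 i) //= dvdn_mulr.
rewrite -(Gauss_dvdl _ p_m) /monomial_gap /distance mulnDl !mulnBl -uE -vE.
exact: dvdn_distance.
Qed.

(** Each such prime divides one of the [(2 * K) ^ r] gaps. The nonzero gaps
    have a product of at most [b * K * (2 * K) ^ r] bits, which bounds the number
    of its prime divisors. *)
Lemma count_collisions (r : nat) (ps : 'I_r -> nat) (K b n : nat) :
  (forall i, prime (ps i)) -> injective ps -> \prod_i ps i <= 2 ^ b ->
  #|[set p : 'I_n | [&& prime p, ~~ (p %| \prod_i ps i) & `[< collision ps K p >]]]%SET|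
    <= b * K * (2 * K) ^ r.
Proof.
have shift_eq x y : y < K -> x + K - y = K -> x = y by lia.
move=> ps_prime ps_inj le_b; set S := [set p | _]%SET.
pose W := {ffun 'I_r -> 'I_(2 * K)}.
pose M (w : W) := monomial_gap ps K (fun i => w i).
have M_le w : M w <= 2 ^ (b * K).
  by apply: distance_le; apply: monomial_le => // i; have := ltn_ord (w i); lia.
rewrite -(leq_exp2l (m := 2)) //.
apply: leq_trans (_ : \prod_(w | 0 < M w) M w <= _); last first.
  apply: leq_trans (_ : \prod_(w : W) 2 ^ (b * K) <= _).
    rewrite big_mkcond leq_prod //= => w _; case: ifP => // _; by rewrite expn_gt0.
  by rewrite prod_nat_const card_ffun !card_ord -expnM.
apply: card_prime_divisors; first exact: prodn_cond_gt0.
move=> p; rewrite inE => /and3P[p_pr p_ps /asboolP[u [v [uv eq_uv]]]]; rewrite p_pr /=.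
have w_lt i : u i + K - v i < 2 * K.
  by have := ltn_ord (u i); have := ltn_ord (v i); lia.
pose w : W := [ffun i => Ordinal (w_lt i)].
have wE i : w i = u i + K - v i :> nat by rewrite ffunE.
have p_dvd : p %| M w.
  have -> : M w = monomial_gap ps K (fun i => u i + K - v i).
    by congr monomial_gap; apply/funext.
  by apply: dvdn_monomial_gap => // i; apply: ltnW.
rewrite (bigD1 w) /=; first exact: dvdn_mulr.
have [i uvi] : exists i, u i != v i.
  apply/existsP; apply: contraR uv => /existsPn eq_uv'.
  by apply/eqP/ffunP => i; apply/eqP; have := eq_uv' i; rewrite negbK.
apply: (monomial_gap_gt0 (i := i)) => //; apply: contra uvi.
by rewrite wE => /eqP/shift_eq eq_i; apply/eqP/val_inj/eq_i.
Qed.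

(** Without collisions the [K ^ r] monomials are distinct modulo [p], and all of
    them are roots of ['X^E - 1], where [E] is the lcm. *)
Lemma lcm_orders_of_no_collision (r : nat) (ps : 'I_r -> nat) (K p : nat)
    (g : 'I_r -> {unit 'F_p}) :
  prime p -> (forall i, val (g i) = (ps i)%:R%R) -> ~ collision ps K p ->
  K ^ r <= \big[lcmn/1]_i #[g i]%g.
Proof.
move=> p_pr gE no_coll; set E := \big[lcmn/1]_i _.
pose z (u : {ffun 'I_r -> 'I_K}) : 'F_p := (monomial ps (fun i => u i))%:R%R.
have z_inj : injective z.
  move=> u v /(congr1 val); rewrite /= !val_Fp_nat // => eq_uv.
  by apply/eqP; apply: contra_notT no_coll => uv; exists u, v.
have -> : K ^ r = size (codom z) by rewrite size_codom card_ffun !card_ord.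
apply: max_unity_roots; first by apply: biglcmn_gt0 => i; apply: order_gt0.
- apply/allP => _ /codomP[u ->]; rewrite unity_rootE.
  have zE : z u = val (\prod_i g i ^+ u i)%g.
    rewrite val_unit_prod /z /monomial natr_prod; apply: eq_bigr => i _.
    by rewrite FinRing.val_unitX gE natrX.
  rewrite zE val_unit_prod -prodrXl big1 // => i _.
  rewrite FinRing.val_unitX -exprM mulnC exprM -FinRing.val_unitX.
  have /eqP-> : (g i ^+ E == 1)%g by rewrite -order_dvdn /E (bigD1 i) //= dvdn_lcml.
  by rewrite expr1n.
by rewrite map_inj_uniq ?enum_uniq.
Qed.

(** * From large orders to almost all primes *)

Lemma dvdn_prod_divisors (A a m n p : nat) :
  prime p -> 0 < A -> a %| A -> 1 < a -> p %| a ^ m + a ^ n + 1 ->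
  p %| \prod_(a <- divisors A | 1 < a) (a ^ m + a ^ n + 1).
Proof.
move=> p_pr A_gt0 aA a_gt1 p_a; rewrite Euclid_dvd_prod // big_has_cond.
by apply/hasP; exists a; rewrite -?dvdn_divisors //= a_gt1.
Qed.

(** With [N], [G], [C] as named in the proof and [h] the order of the best
    monomial, absence of collisions gives [(K ^ r / C) ^ G <= h ^ N]. The
    numerical hypothesis says exactly that this forces [p ^ 3 < h ^ 4]. *)
Lemma solution_of_no_collision (r B K p : nat) (ps : 'I_r -> nat) :
  0 < B -> (forall i, prime (ps i)) -> prime p -> ~~ (p %| \prod_i ps i) ->
  p ^ (3 * (B ^ r).-1) * (B.-1)`! ^ (4 * (B ^ r - B ^ r.-1)) <
    K ^ (4 * r * (B ^ r - B ^ r.-1)) ->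
  ~ collision ps K p ->
  exists m n : nat, [/\ 0 < m, 0 < n &
    p %| \prod_(a <- divisors ((\prod_i ps i) ^ B.-1) | 1 < a) (a ^ m + a ^ n + 1)].
Proof.
set N := (B ^ r).-1; set G := B ^ r - B ^ r.-1; set C := (B.-1)`!.
move=> B_gt0 ps_prime p_pr p_ps p_small no_coll.
have psU i : ((ps i)%:R : 'F_p)%R \is a GRing.unit.
  rewrite unitfE -(dvdn_pcharf (pchar_Fp p_pr)).
  by apply: contra p_ps => p_i; rewrite (bigD1 i) //= dvdn_mulr.
pose g i : {unit 'F_p} := FinRing.unit 'F_p (psU i).
have [e le_h] := exists_large_order g B_gt0.
have := lcm_orders_of_no_collision p_pr (g := g) (fun=> erefl) no_coll.
set E := \big[lcmn/1]_i _ in le_h *; set L := E %/ _ in le_h.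
set x : {unit 'F_p} := (\prod_i _)%g in le_h => le_E.
have E_le : E <= L * C.
  rewrite -[leqLHS](divnK (dvdn_gcdl E C)) leq_mul2l.
  by rewrite (dvdn_leq (fact_gt0 _)) ?orbT // dvdn_gcdr.
have ord_large : p ^ 3 < #[x]%g ^ 4.
  rewrite ltnNge; apply: contraL p_small => small; rewrite -leqNgt.
  apply: leq_trans (_ : (#[x]%g ^ N) ^ 4 * C ^ (4 * G) <= _); last first.
    by rewrite leq_mul // -expnM mulnC !expnM leq_expn.
  apply: leq_trans (_ : (L ^ G) ^ 4 * C ^ (4 * G) <= _); last first.
    by rewrite leq_mul // leq_expn.
  rewrite -expnM [G * 4]mulnC -expnMn -mulnA mulnCA expnM leq_expn //.
  exact: leq_trans le_E E_le.
have xE : val x = ((monomial ps (fun i => e i))%:R)%R.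
  rewrite val_unit_prod /monomial natr_prod; apply: eq_bigr => i _.
  by rewrite FinRing.val_unitX natrX.
have [|y [z [yx zx yz0]]] := @solution_of_large_subgroup 'F_p <[x]>%G.
  by rewrite card_Fp.
have exponent w : w \in <[x]>%G ->
    exists2 m, 0 < m & val w = ((monomial ps (fun i => e i)) ^ m)%:R%R.
  (* The order of [x] is added to make the exponent positive. *)
  move=> /cycleP[m ->]; exists (m + #[x]%g); first by rewrite addn_gt0 order_gt0 orbT.
  by rewrite natrX -xE -FinRing.val_unitX expgD expg_order mulg1.
have [m m_gt0 yE] := exponent y yx; have [n n_gt0 zE] := exponent z zx.
exists m, n; split=> //; apply: (dvdn_prod_divisors (a := monomial ps (fun i => e i))) => //.
- by rewrite expn_gt0 prodn_gt0 // => i; rewrite prime_gt0.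
- rewrite (big_morph (fun x => x ^ B.-1) (fun x y => expnMn x y B.-1) (exp1n _)).
  rewrite /monomial; apply: (big_ind2 (fun a b => a %| b)) => // [a b c d|i _].
    exact: dvdn_mul.
  by apply: dvdn_exp2l; rewrite -ltnS prednK.
- rewrite ltn_neqAle monomial_gt0 // andbT; apply: contraTneq ord_large => a1.
  have -> : x = 1%g by apply: val_inj; rewrite xE -a1.
  by rewrite order1 -leqNgt exp1n expn_gt0 prime_gt0.
by rewrite (dvdn_pcharf (pchar_Fp p_pr)) !natrD -yE -zE yz0.
Qed.

Lemma small_power_bound (C N G r j k n p y : nat) :
  3 * N * k < 4 * r * G * j -> 2 ^ (3 * N * k) * C < y ->
  n < y.+1 ^ k -> p <= n -> p ^ (3 * N) * C < (y ^ j) ^ (4 * r * G).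
Proof.
move=> exponents y_large n_lt p_le.
have y_gt0 : 0 < y by apply: leq_ltn_trans y_large.
have p_le2y : p <= (2 * y) ^ k.
  by rewrite (leq_trans p_le) // (leq_trans (ltnW n_lt)) // leq_expn //; lia.
apply: leq_ltn_trans (_ : y ^ (3 * N * k) * (2 ^ (3 * N * k) * C) < _).
  rewrite mulnA leq_mul // -expnMn [y * 2]mulnC [_ * k]mulnC [leqRHS]expnM.
  exact: leq_expn.
apply: leq_trans (_ : y ^ (3 * N * k).+1 <= _).
  by rewrite expnSr ltn_pmul2l // expn_gt0 y_gt0.
by rewrite -expnM [j * _]mulnC leq_pexp2l.
Qed.

(** Every [x] lies between two consecutive powers [y ^ k.+2] and
    [y.+1 ^ k.+2]. Then [ln x <= k.+2 * y], so a bound [C * y ^ k] for the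
    exceptions, once multiplied by [ln x], is still smaller than
    [y ^ k.+2 <= x] by a factor of order [y]. Indexing by [y] avoids real powers
    of [x]. *)
Lemma almost_all_primes_of_power_saving (R : realType) (P : nat -> Prop) (C Y k : nat) :
  (forall y n, Y <= y -> y ^ k.+2 <= n -> n < y.+1 ^ k.+2 ->
    #|[set p : 'I_n.+1 | prime p && `[< ~ P p >]]%SET| <= C * y ^ k) ->
  almost_all_primes R P.
Proof.
move=> bound; apply/eqoP => eps eps_gt0.
pose Y0 := maxn (maxn Y 2) (Num.truncn (C%:R * k.+2%:R / eps)%R).+1.
have Y0_gt1 : 1 < Y0 by rewrite /Y0; lia.
exists (Y0 ^ k.+2)%:R%R; split; first exact: realn.
move=> x x_large; set n := Num.truncn x.
have x_ge0 : (0 <= x)%R by rewrite (le_trans _ (ltW x_large)).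
have n_large : Y0 ^ k.+2 <= n by rewrite truncn_ge_nat // ltW.
have [y y_le y_max] : exists2 y, y ^ k.+2 <= n & n < y.+1 ^ k.+2.
  have ex : exists y, y ^ k.+2 <= n by exists Y0.
  have ub y : y ^ k.+2 <= n -> y <= n.
    move=> le; rewrite (leq_trans _ le) // -[leqLHS]expn1.
    by case: y {le} => // y; rewrite leq_pexp2l.
  case: (ex_maxnP ex ub) => y le_y max_y; exists y => //.
  by rewrite ltnNge; apply/negP => /max_y; rewrite ltnn.
have y_large : Y0 <= y.
  by rewrite -ltnS -(ltn_exp2r _ _ (ltn0Sn k.+1)) (leq_ltn_trans n_large).
have x_lt : (x < y.+1%:R ^+ k.+2)%R by rewrite -natrX -truncn_lt_nat.
have x_gt1 : (1 < x)%R.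
  apply: lt_trans x_large; rewrite ltr1n -[X in X < _](exp1n k.+2) ltn_exp2r //.
have ln_gt0x : (0 < ln x)%R by rewrite ln_gt0.
have ln_le : (ln x <= k.+2%:R * y%:R)%R.
  apply: le_trans (_ : ln (y.+1%:R ^+ k.+2) <= _)%R.
    by rewrite ler_ln ?posrE ?exprn_gt0 ?ltr0n // ?ltW // (lt_trans ltr01).
  rewrite lnXn ?ltr0n // -[leLHS]mulr_natl ler_wpM2l //.
  by rewrite -natr1 addrC le_ln1Dx // (lt_le_trans _ (ler0n _ _)) // ltrN10.
rewrite ger0_norm ?ler0n // ger0_norm ?divr_ge0 ?(ltW ln_gt0x) // mulrA ler_pdivlMr //.
have count_le : (prime_exceptions P x <= C * y ^ k)%N.
  by apply: bound => //; move: y_large; rewrite /Y0; lia.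
apply: le_trans (_ : (C%:R * y%:R ^+ k) * (k.+2%:R * y%:R) <= _)%R.
  apply: ler_pM => //; first exact: ltW.
  by rewrite -natrX -natrM ler_nat.
have Ck : (C%:R * k.+2%:R <= eps * y%:R)%R.
  rewrite -ler_pdivrMl // mulrC.
  rewrite ltW // -truncn_lt_nat; last by rewrite divr_ge0 ?mulr_ge0 // ltW.
  by apply: leq_trans y_large; rewrite /Y0 leq_max leqnn orbT.
apply: le_trans (_ : eps * (y ^ k.+2)%:R <= _)%R; last first.
  rewrite ler_pM2l //; apply: le_trans (_ : n%:R <= _)%R; first by rewrite ler_nat.
  by rewrite truncn_le.
rewrite natrX !exprS; move: (ler_wpM2r (exprn_ge0 k.+1 (ler0n R y)) Ck).
rewrite exprS; congr (_ <= _)%R; ring.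
Qed.

(** The numerical hypothesis reads
    [3 / 4 < r / r.+1 * ((B ^ r - B ^ r.-1) / (B ^ r).-1)]. The first factor is the
    exponent of [p] reached by the subgroup generated by [r] primes, for almost
    all [p]; the second is the part of it kept by the best single monomial. *)
Theorem almost_all_primes_divide_product (R : realType) (r B : nat) (ps : 'I_r -> nat) :
  0 < B -> (forall i, prime (ps i)) -> injective ps ->
  3 * r.+1 * (B ^ r).-1 < 4 * r * (B ^ r - B ^ r.-1) ->
  almost_all_primes R (fun p : nat =>
    exists m n : nat, [/\ 0 < m, 0 < n &
      p %| \prod_(a <- divisors ((\prod_i ps i) ^ B.-1) | 1 < a) (a ^ m + a ^ n + 1)]).
Proof.
set N := (B ^ r).-1; set G := B ^ r - B ^ r.-1 => B_gt0 ps_prime ps_inj exponents.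
pose b := \prod_i ps i; pose j := (6 * N).+1; pose k := j * r.+1.
pose C := (B.-1)`! ^ (4 * G).
(* With [K = y ^ j], collisions number [O(y ^ k)], and the modulus is about
   [y ^ k.+2]. The loss of the two extra factors [y] costs [6 * N] in the
   exponent, and [j > 6 * N] copies of the strict inequality [exponents] pay
   for it. *)
apply: (@almost_all_primes_of_power_saving R _ (b + b * 2 ^ r)
  (2 ^ (3 * N * k.+2) * C).+1 k) => y n y_large y_le n_lt.
set K := y ^ j.
pose S1 := [set p : 'I_n.+1 | prime p && (p %| b)]%SET.
pose S2 := [set p : 'I_n.+1 | [&& prime p, ~~ (p %| b) & `[< collision ps K p >]]]%SET.
have y_gt0 : 0 < y by apply: leq_trans y_large.
have b_gt0 : 0 < b by rewrite prodn_gt0 // => i; rewrite prime_gt0.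
apply: leq_trans (_ : #|S1| + #|S2| <= _).
  apply: leq_trans (leq_card_setU _ _); apply: subset_leq_card.
  apply/fintype.subsetP => p; rewrite !inE => /andP[p_pr /asboolP no_sol].
  rewrite p_pr /=; have [//|p_b /=] := boolP (p %| b).
  apply/asboolP; apply: contrapT => no_coll; apply: no_sol.
  apply: solution_of_no_collision no_coll => //.
  apply: small_power_bound n_lt _ => //; last by rewrite -ltnS.
  have -> : 3 * N * k.+2 = 3 * r.+1 * N * j + 6 * N by rewrite /k; ring.
  apply: leq_trans (_ : (3 * r.+1 * N).+1 * j <= _); last by rewrite leq_mul2r exponents orbT.
  by rewrite [_.+1 * j]mulSn addnC ltn_add2r.
have S1_le : #|S1| <= b.
  apply: leq_trans (ltnW (ltn_expl _ (ltnSn 1))) _.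
  by apply: card_prime_divisors => // p; rewrite inE.
have S2_le : #|S2| <= b * K * (2 * K) ^ r.
  by apply: count_collisions => //; apply/ltnW/ltn_expl.
apply: leq_trans (leq_add S1_le S2_le) _; rewrite mulnDl leq_add //.
  by rewrite leq_pmulr // expn_gt0 y_gt0.
by rewrite expnMn mulnACA /k expnM expnS.
Qed.

Theorem corollary1p3 (R : realType) :
  almost_all_primes R (fun p : nat =>
    exists m n : nat,
      [/\ (0 < m)%N, (0 < n)%N
        & (p %| \prod_(a <- divisors ((2 * 3 * 5 * 7 * 11) ^ 9) | 1 < a)
                  (a ^ m + a ^ n + 1))%N]).
Proof.
pose ps (i : 'I_5) := nth 0 [:: 2; 3; 5; 7; 11] i.
have -> : 2 * 3 * 5 * 7 * 11 = \prod_i ps i by rewrite !big_ord_recl big_ord0 /= muln1 !mulnA.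
apply: (@almost_all_primes_divide_product R 5 10 ps).
- by [].
- by case=> [[|[|[|[|[|i]]]]] lt_i5].
- by move=> [[|[|[|[|[|i]]]]] ?] [[|[|[|[|[|j]]]]] ?] // _; apply: val_inj.
(* With [t = 10 ^ 4] this is [18 * (10 * t - 1) < 20 * (9 * t)]. *)
rewrite [10 ^ 5]expnS [5.-1]/=; move: (10 ^ 4) (expn_gt0 10 4) => t t_gt0.
by lia.
Qed.
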